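(* Let $r\geq 3$ be an integer, let $c>0$ be a real number, and let $n$ be a positive integer such that $\left(c/r^{r}\right)^{r}\ln n\geq 1$. Let $G$ be a graph with $n$ vertices. If \[ \mu(G)\geq\left(1-\frac{1}{r-1}+c\right)n, \] then $G$ contains a (not necessarily induced) subgraph isomorphic to $K_{r}(s,\ldots,s,t)$ with $s\geq\left\lfloor \left(c/r^{r}\right)^{r}\ln n\right\rfloor$ and $t>n^{1-c^{r-1}}$.
   Context: All graphs are finite, simple and undirected. $\mu(G)$ denotes the largest eigenvalue of the adjacency matrix of $G$. $K_{r}(s_{1},\ldots,s_{r})$ denotes the complete $r$-partite graph with parts of sizes $s_{1},\ldots,s_{r}$; thus $K_{r}(s,\ldots,s,t)$ is the complete $r$-partite graph with $r-1$ parts of size $s$ and one part of size $t$. $\ln$ is the natural logarithm. *)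

(* Defs.v *)
From HB Require Import structures.
From mathcomp Require Import all_boot all_order all_algebra.
From mathcomp Require Import boolp classical_sets reals.
From mathcomp Require Import complex.

Set Implicit Arguments.
Unset Strict Implicit.
Unset Printing Implicit Defensive.
Import Order.TTheory GRing.Theory Num.Theory.
Local Open Scope ring_scope.

Record sgraph := SGraph {
  vertex : finType;
  adj : rel vertex;
  adj_sym : symmetric adj;
  adj_irr : irreflexive adj
}.

Section Spectrum.
Variables (R : realType) (G : sgraph).

Definition adjmx : 'M[R]_#|vertex G| :=
  \matrix_(i, j) (adj (enum_val i) (enum_val j))%:R.

(* For a nonempty graph the supremum is attained: see [largest_eigenvalueP]. *)
Definition largest_eigenvalue : R :=
  sup [set a : R | eigenvalue adjmx a]%classic.

Lemma adjmx_sym : adjmx^T = adjmx.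
Proof. by apply/matrixP => i j; rewrite !mxE adj_sym. Qed.

Lemma adjmx_eigenvalue_exists :
  (0 < #|vertex G|)%N -> exists a : R, eigenvalue adjmx a.
Proof.
move=> G_gt0; pose C : closedFieldType := R[i].
pose f : {rmorphism R -> C} := complex.real_complex R.
pose g : {rmorphism C -> C} := @complex.conjc R.
have [z] : exists z : C, root (map_poly f (char_poly adjmx)) z.
  apply/closed_rootP; rewrite size_map_poly size_char_poly.
  by case: #|_| G_gt0.
rewrite map_char_poly -eigenvalue_root_char => /eigenvalueP[v vA v0].
have gz : g z = z.
  have gA : map_mx g (map_mx f adjmx) = map_mx f adjmx.
    by apply/matrixP => i j; rewrite !mxE !rmorph_nat.
  pose w := map_mx g v.
  have wA : w *m map_mx f adjmx = g z *: w.
    by rewrite -{1}gA -map_mxM vA map_mxZ.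
  have h1 : v *m map_mx f adjmx *m w^T = z *: (v *m w^T).
    by rewrite vA -scalemxAl.
  have h2 : v *m map_mx f adjmx *m w^T = g z *: (v *m w^T).
    have fA : map_mx f adjmx = (map_mx f adjmx)^T.
      by apply/matrixP => i j; rewrite !mxE adj_sym.
    rewrite -mulmxA {1}fA -trmx_mul wA.
    by rewrite linearZ /= -scalemxAr.
  have vw0 : (v *m w^T) 0 0 != 0.
    apply: contraNneq v0; rewrite mxE => /eqP.
    rewrite psumr_eq0 => [/allP S0|i _]; last first.
      by rewrite !mxE; exact: complex.mulcJ_ge0.
    apply/eqP/matrixP => i j; rewrite (ord1 i) [RHS]mxE.
    have := S0 j (mem_index_enum _); rewrite !mxE /= mulf_eq0.
    by rewrite fmorph_eq0 orbb => /eqP.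
  apply: (mulIf vw0).
  by move: h1; rewrite h2 => /matrixP /(_ 0 0); rewrite !mxE.
have [x zx] : exists x, z = f x.
  case: z gz {vA} => a b [] /eqP; rewrite eqNr => /eqP ->.
  by exists a.
exists x; rewrite eigenvalue_root_char -(fmorph_root f) map_char_poly.
by rewrite -eigenvalue_root_char -zx; apply/eigenvalueP; exists v.
Qed.

Lemma largest_eigenvalueP : (0 < #|vertex G|)%N ->
  eigenvalue adjmx largest_eigenvalue /\
  forall a, eigenvalue adjmx a -> a <= largest_eigenvalue.
Proof.
move=> /adjmx_eigenvalue_exists[a0 a0A].
have p0 : char_poly adjmx != 0 by rewrite monic_neq0 ?char_poly_monic.
have [s sE] : exists s : seq R, forall a, eigenvalue adjmx a = (a \in s).
  suff [s sP] : exists s : seq R, forall a, root (char_poly adjmx) a = (a \in s).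
    by exists s => a; rewrite eigenvalue_root_char.
  have [n] := ubnP (size (char_poly adjmx)).
  elim: n (char_poly adjmx) p0 => // n IH p p0 ps.
  have [[a pa]|nr] := pselect (exists a, root p a); last first.
    by exists [::] => a; apply/negP => pa; apply: nr; exists a.
  have /factor_theorem[q qE] := pa.
  have q0 : q != 0 by apply: contraNneq p0; rewrite qE => ->; rewrite mul0r.
  have [|s sP] := IH q q0.
    by move: ps; rewrite qE size_Mmonic ?monicXsubC// size_XsubC addn2.
  by exists (a :: s) => b; rewrite qE rootM root_XsubC sP inE orbC.
have {}a0A : a0 \in s by rewrite -sE.
pose m := \big[Order.max/a0]_(a <- s) a.
have mle a : a \in s -> a <= m by move=> ?; exact: le_bigmax_seq.
have ms : m \in s.
  rewrite /m big_seq; apply: (big_ind (fun x => x \in s)) => // x y xs ys.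
  by case: leP.
suff -> : largest_eigenvalue = m by rewrite sE; split=> // a; rewrite sE => /mle.
apply/eqP; rewrite eq_le; apply/andP; split.
  by apply: ge_sup => [|a /=]; [exists a0; rewrite /= sE | rewrite sE => /mle].
apply: ub_le_sup; last by rewrite /= sE.
by exists m => a /=; rewrite sE => /mle.
Qed.

End Spectrum.

Section Multipartite.
Variable p : seq nat.

Definition multipart_adj : rel {i : 'I_(size p) & 'I_(nth 0%N p i)} :=
  fun x y => tag x != tag y.

Lemma multipart_adj_sym : symmetric multipart_adj.
Proof. by move=> x y; rewrite /multipart_adj eq_sym. Qed.

Lemma multipart_adj_irr : irreflexive multipart_adj.
Proof. by move=> x; rewrite /multipart_adj eqxx. Qed.

(* The part sizes are the entries of [p]. *)
Definition complete_multipartite : sgraph :=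
  SGraph multipart_adj_sym multipart_adj_irr.

End Multipartite.

(* [H] is isomorphic to a not necessarily induced subgraph of [G]. *)
Definition contains_subgraph (G H : sgraph) : Prop :=
  exists f : vertex H -> vertex G,
    injective f /\ forall x y, adj x y -> adj (f x) (f y).

(* Main.v *)
(* The eigenvector for the largest eigenvalue gives, after taking absolute
   values, a probability weight [w] on the vertices with [w <= O(1/n)] whose
   weighted edge density is at least [1 - 1/(r-1) + c]. The Moon-Moser
   inequalities for weighted graphs then give at least [c / r^(r-1) * n^r]
   ordered [r]-cliques. Put [q = c / (2 r^r)]. Every clique is rich at level 0;
   it is rich at level [j+1] when at least [2 q n] one-vertex
   extensions of it are rich at level [j]; counting shows that the empty clique
   is rich at level [r]. The multipartite subgraph is built one part at a time:
   from [m] disjoint rich cliques spanning a complete multipartite graph, a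
   pigeonhole over the [2^m] subsets of them selects [q m] cliques having
   [q n / 2^m] common rich extensions. Logarithmically many cliques survive to
   the end, and [2^m] stays below a small power of [n] throughout. *)
Require Import Defs.
From mathcomp Require Import all_boot all_order all_algebra.
From mathcomp Require Import reals sequences exp.
From mathcomp Require Import ring lra.
Set Implicit Arguments.
Unset Strict Implicit.
Unset Printing Implicit Defensive.
Import Order.TTheory GRing.Theory Num.Theory.
Local Open Scope ring_scope.

(** * Weighted clique sums and the Moon-Moser inequality *)

Section CliqueSums.
Variables (R : realFieldType) (G : sgraph).
Local Notation V := (vertex G).
Implicit Types (u v : V) (P Q : {set V}) (w : V -> R) (F : {set V} -> R).

Definition joined u Q : bool := Q \subset [set v | adj u v].

Lemma joinedU1 u v Q : joined u (v |: Q) = adj u v && joined u Q.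
Proof. by rewrite /joined subUset sub1set inE. Qed.

Lemma joined_sub u P Q : Q \subset P -> joined u P -> joined u Q.
Proof. exact: subset_trans. Qed.

(* Sum of [F] over the ordered cliques [u_1, ..., u_k] of common neighbours of
   [Q], each with weight [w u_1 * ... * w u_k], evaluated at [Q] enlarged by
   the clique. *)
Fixpoint csum w k F Q : R :=
  if k is k'.+1 then \sum_(u | joined u Q) w u * csum w k' F (u |: Q) else F Q.

Definition cliques w k : {set V} -> R := csum w k (fun=> 1).

Definition wdeg w Q : R := \sum_(u | joined u Q) w u.

Lemma csum_le w k F F' Q : (forall u, 0 <= w u) ->
  (forall P, Q \subset P -> F P <= F' P) -> csum w k F Q <= csum w k F' Q.
Proof.
move=> w0; elim: k Q => [|k IH] Q FF' /=; first exact: FF'.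
apply: ler_sum => u _; rewrite ler_wpM2l// IH// => P uQP.
by apply/FF'/(subset_trans _ uQP)/subsetU1.
Qed.

Lemma eq_csum w k F F' Q : F =1 F' -> csum w k F Q = csum w k F' Q.
Proof.
by move=> FF'; elim: k Q => [|k IH] Q //=; under eq_bigr do rewrite IH.
Qed.

Lemma csumD w k F F' Q :
  csum w k (fun P => F P + F' P) Q = csum w k F Q + csum w k F' Q.
Proof.
elim: k Q => [|k IH] Q //=; rewrite -big_split.
by under eq_bigr do rewrite IH mulrDr.
Qed.

Lemma csumZ w k a F Q : csum w k (fun P => a * F P) Q = a * csum w k F Q.
Proof.
elim: k Q => [|k IH] Q //=; rewrite mulr_sumr.
by under eq_bigr do rewrite IH mulrCA.
Qed.

Lemma csum_sum w k (H : V -> {set V} -> R) Q :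
  csum w k (fun P => \sum_u H u P) Q = \sum_u csum w k (H u) Q.
Proof.
elim: k Q => [|k IH] Q //=; rewrite exchange_big; apply: eq_bigr => u _ /=.
by rewrite IH mulr_sumr.
Qed.

(** Being joined to an extension of [Q] means being joined to [Q] and to each added vertex; by
    symmetry of [adj] the latter constrains the added vertices, so [u] may be chosen first. *)
Lemma csum_joined w k F u Q :
  csum w k (fun P => (joined u P)%:R * F (u |: P)) Q =
  (joined u Q)%:R * csum w k F (u |: Q).
Proof.
elim: k Q => [|k IH] Q //=.
under eq_bigr do rewrite IH joinedU1.
rewrite mulr_sumr [LHS]big_mkcond [RHS]big_mkcond; apply: eq_bigr => v _.
rewrite joinedU1 adj_sym setUCA; case: (joined v Q); rewrite ?andbF//.
by case: (adj v u); rewrite /= ?mul0r ?mulr0 // mulrCA.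
Qed.

Lemma csumSE w k F Q : csum w k.+1 F Q =
  \sum_u w u * csum w k (fun P => (joined u P)%:R * F (u |: P)) Q.
Proof.
rewrite /= big_mkcond; apply: eq_bigr => u _; rewrite csum_joined.
by case: ifP; rewrite ?mul1r ?mul0r ?mulr0.
Qed.

Lemma wdegE w Q : wdeg w Q = \sum_u w u * (joined u Q)%:R.
Proof.
rewrite /wdeg big_mkcond; apply: eq_bigr => u _.
by case: ifP; rewrite ?mulr1 ?mulr0.
Qed.

Lemma cliques_ge0 w k Q : (forall u, 0 <= w u) -> 0 <= cliques w k Q.
Proof.
move=> w0; apply: le_trans (csum_le k (F := fun=> 0 * 1) w0 _); last first.
  by move=> P _; rewrite mul0r.
by rewrite csumZ mul0r.
Qed.

Lemma cliquesS w k Q : cliques w k.+1 Q = csum w k (wdeg w) Q.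
Proof.
rewrite /cliques; elim: k Q => [|k IH] Q; last first.
  by apply: eq_bigr => u _; congr (_ * _); exact: IH.
by apply: eq_bigr => u _; rewrite mulr1.
Qed.

(** Enlarging [Q] to [P] shrinks the set of common neighbours lying outside the neighbourhood of
    [u], whose weight is [wdeg w Q - wdeg w (u |: Q)]. *)
Lemma wdeg_submod w u P Q : (forall u, 0 <= w u) -> Q \subset P ->
  wdeg w (u |: Q) + wdeg w P <= wdeg w Q + wdeg w (u |: P).
Proof.
move=> w0 QP; rewrite !wdegE -!big_split; apply: ler_sum => v _ /=.
rewrite -!mulrDr ler_wpM2l// -!natrD ler_nat !joinedU1.
have := @joined_sub v _ _ QP.
by case: (joined v P) (joined v Q) (adj v u) => [] [] [] // /(_ isT).
Qed.

(* Moon and Moser's inequality, relative to a fixed clique [Q]. Fixing the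
   first vertex [u] of the extension makes it follow by induction from the
   submodularity of the common degree. *)
Lemma moon_moser w k Q : (forall u, 0 <= w u) ->
  k.+1%:R * csum w k (fun P => wdeg w P * wdeg w P) Q <=
  wdeg w Q * cliques w k.+1 Q + k%:R * cliques w k.+2 Q.
Proof.
move=> w0; elim: k Q => [|k IH] Q.
  by rewrite mul1r mul0r addr0 cliquesS.
pose X := csum w k.+1 (fun P => wdeg w P * wdeg w P) Q.
pose Y := \sum_(u | joined u Q) w u * (wdeg w (u |: Q) * cliques w k.+1 (u |: Q)).
have le1 : k.+1%:R * X <= Y + k%:R * cliques w k.+3 Q.
  rewrite [X in k%:R * X]/cliques /X [csum _ k.+1 _ _]/=.
  rewrite [csum _ k.+3 _ _]/= !mulr_sumr -big_split.
  apply: ler_sum => u _; rewrite -/(csum w k.+2 _ _) -/(cliques w k.+2 _) /=.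
  by rewrite mulrCA [X in _ + X]mulrCA -mulrDr ler_wpM2l.
(* Added to [le1], this is the claim. As sums over [u] and extensions [P] of [Q] joined to [u], the
   four terms carry the degrees of [u |: Q], [P], [Q] and [u |: P], so [wdeg_submod] applies
   termwise. *)
suff le2 : Y + X <= wdeg w Q * cliques w k.+2 Q + cliques w k.+3 Q.
  rewrite -/X -(natr1 k.+1) mulrDl mul1r.
  have -> : k.+1%:R * cliques w k.+3 Q = k%:R * cliques w k.+3 Q + cliques w k.+3 Q.
    by rewrite -natr1 mulrDl mul1r.
  lra.
have -> : X = \sum_u w u *
    csum w k.+1 (fun P => (joined u P)%:R * wdeg w P) Q.
  rewrite /X; transitivity (csum w k.+1
      (fun P => \sum_u w u * ((joined u P)%:R * wdeg w P)) Q).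
    apply: eq_csum => P; rewrite {1}wdegE mulr_suml.
    by apply: eq_bigr => u _; rewrite mulrA.
  by rewrite csum_sum; apply: eq_bigr => u _; rewrite csumZ.
have -> : Y = \sum_u w u *
    csum w k.+1 (fun P => wdeg w (u |: Q) * ((joined u P)%:R * 1)) Q.
  rewrite /Y big_mkcond; apply: eq_bigr => u _.
  rewrite csumZ (csum_joined w k.+1 (fun=> 1)) -/(cliques _ _ _).
  by case: ifP; rewrite ?mul1r ?mul0r ?mulr0.
have -> : cliques w k.+3 Q = \sum_u w u *
    csum w k.+1 (fun P => (joined u P)%:R * wdeg w (u |: P)) Q.
  rewrite cliquesS csumSE; apply: eq_bigr => u _.
  by rewrite csum_joined -(csum_joined w k.+1).
have -> : wdeg w Q * cliques w k.+2 Q = \sum_u w u *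
    csum w k.+1 (fun P => wdeg w Q * ((joined u P)%:R * 1)) Q.
  rewrite [cliques _ _ _]csumSE mulr_sumr.
  by apply: eq_bigr => u _; rewrite csumZ mulrCA.
move: (k.+1) => m; rewrite -!big_split; apply: ler_sum => u _ /=.
rewrite -!mulrDr ler_wpM2l// -!csumD; apply: csum_le => // P QP.
rewrite mulrCA [X in _ <= X + _]mulrCA -!mulrDr ler_wpM2l// !mulr1.
exact: wdeg_submod.
Qed.


(** With [b] the previous ratio bound, expanding [(wdeg w P - b) ^+ 2 >= 0] bounds the sum of
    squared degrees from below; Moon-Moser bounds it from above, and together they give the next
    ratio. *)
Lemma cliques_ratio w a k : (forall u, 0 <= w u) -> wdeg w set0 = 1 -> a <= 1 ->
  a <= cliques w 2 set0 -> 0 <= 1 - k%:R * (1 - a) ->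
  (1 - k.+1%:R * (1 - a)) * cliques w k.+1 set0 <= cliques w k.+2 set0.
Proof.
move=> w0 w1 a1 wa; elim: k => [|k IH] ak0.
  by rewrite cliquesS [csum _ 0 _ _]/= w1 mulr1; lra.
pose b := 1 - k.+1%:R * (1 - a); rewrite -/b in ak0 IH.
have {}IH : b * cliques w k.+1 set0 <= cliques w k.+2 set0.
  by apply: IH; apply: (le_trans ak0); rewrite /b -natr1; lra.
have sq : 2 * b * cliques w k.+2 set0 - b ^+ 2 * cliques w k.+1 set0 <=
    csum w k.+1 (fun P => wdeg w P * wdeg w P) set0.
  rewrite cliquesS -2!csumZ -mulN1r -csumZ -csumD; apply: csum_le => // P _.
  by rewrite -subr_ge0; have := sqr_ge0 (wdeg w P - b); congr (0 <= _); ring.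
have := moon_moser k.+1 set0 w0; rewrite w1 mul1r => mm.
have bb : b * (b * cliques w k.+1 set0) <= b * cliques w k.+2 set0.
  by rewrite ler_wpM2l.
rewrite -(ler_pM2l (_ : 0 < k.+1%:R :> R)) ?ltr0n//.
have -> : k.+1%:R * ((1 - k.+2%:R * (1 - a)) * cliques w k.+2 set0) =
    k.+2%:R * (b * cliques w k.+2 set0) - cliques w k.+2 set0.
  by rewrite /b -[k.+2%:R]natr1; ring.
rewrite lerBlDl; apply: le_trans mm; rewrite ler_wpM2l ?ler0n//.
by apply: le_trans sq; rewrite expr2 -mulrA; lra.
Qed.

Lemma cliques_prod w a k : (forall u, 0 <= w u) -> wdeg w set0 = 1 -> a <= 1 ->
  a <= cliques w 2 set0 -> 0 <= 1 - k%:R * (1 - a) ->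
  \prod_(i < k) (1 - i.+1%:R * (1 - a)) <= cliques w k.+1 set0.
Proof.
move=> w0 w1 a1 wa; elim: k => [|k IH] ak0.
  by rewrite big_ord0 cliquesS [csum _ _ _ _]/= w1.
have ak1 : 0 <= 1 - k%:R * (1 - a).
  by apply: (le_trans ak0); rewrite -natr1; lra.
rewrite big_ord_recr /= mulrC.
apply: le_trans (cliques_ratio w0 w1 a1 wa ak1).
by rewrite ler_wpM2l// IH.
Qed.

Lemma cliques_scale w b k Q : (forall u, 0 <= w u) -> (forall u, w u <= b) ->
  cliques w k Q <= b ^+ k * cliques (fun=> 1) k Q.
Proof.
move=> w0 wb; elim: k Q => [|k IH] Q; first by rewrite mul1r.
rewrite exprS -mulrA mulr_sumr mulr_sumr; apply: ler_sum => u _.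
rewrite mul1r ler_pM// ?IH//; exact: cliques_ge0.
Qed.

End CliqueSums.

(** * From the largest eigenvalue to a count of cliques *)

(* The absolute value [z] of an eigenvector satisfies [mu z <= A z] entrywise,
   which is all that is needed: no Perron-Frobenius argument is used. *)
Lemma spectral_weight (R : realType) (G : sgraph) (a : R) :
  (0 < #|vertex G|)%N -> 0 < a ->
  a * #|vertex G|%:R <= largest_eigenvalue R G ->
  exists w : vertex G -> R,
    [/\ forall u, 0 <= w u, forall u, w u <= (a * #|vertex G|%:R)^-1,
        wdeg w set0 = 1 & a <= cliques w 2 set0].
Proof.
move=> n0 a0 amu; set V := vertex G in n0 amu *; set n := #|V| in n0 amu *.
pose mu := largest_eigenvalue R G; rewrite -/mu in amu.
have nR : 0 < n%:R :> R by rewrite ltr0n.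
have mu0 : 0 < mu by apply: lt_le_trans amu; rewrite mulr_gt0.
have [/eigenvalueP[v vA v0] _] := largest_eigenvalueP R n0.
pose z (u : V) := `|v 0 (enum_rank u)|.
have z_ge0 u : 0 <= z u by exact: normr_ge0.
have zA u : mu * z u <= \sum_(t | adj t u) z t.
  have := congr1 (fun x : 'rV_#|V| => x 0 (enum_rank u)) vA; rewrite !mxE => E.
  rewrite /z -(ger0_norm (ltW mu0)) -normrM -E.
  rewrite (reindex (@enum_rank V)) /=; last exact/onW_bij/enum_rank_bij.
  rewrite [X in _ <= X]big_mkcond; apply: (le_trans (ler_norm_sum _ _ _)).
  apply: ler_sum => t _; rewrite mxE !enum_rankK.
  by case: ifP; rewrite ?mulr1 ?mulr0 ?normr0.
pose Z := \sum_u z u.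
have Z0 : 0 < Z.
  rewrite lt_def sumr_ge0// andbT; apply: contraNneq v0 => /eqP.
  rewrite psumr_eq0// => /allP zv; apply/eqP/rowP => i; rewrite mxE.
  have := zv (enum_val i) (mem_index_enum _).
  by rewrite /z enum_valK normr_eq0 => /eqP.
pose w u := z u / Z.
have w0 u : 0 <= w u by rewrite divr_ge0// ltW.
have sw : \sum_u w u = 1 by rewrite -mulr_suml divff// gt_eqF.
have wA u : mu * w u <= \sum_(t | adj t u) w t.
  by rewrite -mulr_suml mulrA ler_wpM2r ?zA// invr_ge0 ltW.
have w1 : wdeg w set0 = 1.
  by rewrite -sw; apply: eq_bigl => u; rewrite /joined sub0set.
exists w; split=> // [u|].
  apply: (@le_trans _ _ mu^-1); last by rewrite lef_pV2 ?posrE ?mulr_gt0.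
  rewrite -(ler_pM2l mu0) divff ?gt_eqF//; apply: (le_trans (wA u)).
  by rewrite -sw [X in X <= _]big_mkcond; apply: ler_sum => t _; case: ifP.
rewrite cliquesS /=.
(* Cauchy-Schwarz for total weight 1, via the squared deviations of [w] from its mean. *)
have sw2 : n%:R^-1 <= \sum_u w u ^+ 2.
  have : 0 <= \sum_u (w u - n%:R^-1) ^+ 2 by apply: sumr_ge0 => u _; exact: sqr_ge0.
  have -> : \sum_u (w u - n%:R^-1) ^+ 2 =
      \sum_u (w u ^+ 2 + (- (2 * n%:R^-1)) * w u + n%:R^-1 ^+ 2).
    by apply: eq_bigr => u _; ring.
  rewrite !big_split /= -mulr_sumr sw mulr1 sumr_const -/n.
  have -> : n%:R^-1 ^+ 2 *+ n = n%:R^-1 :> R.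
    by rewrite -mulr_natr; field; rewrite gt_eqF.
  lra.
apply: (@le_trans _ _ (mu * \sum_u w u ^+ 2)).
  apply: (@le_trans _ _ (mu / n%:R)); first by rewrite ler_pdivlMr.
  by rewrite ler_wpM2l// ltW.
rewrite mulr_sumr big_mkcond [X in _ <= X]big_mkcond; apply: ler_sum => u _ /=.
rewrite /joined sub0set expr2 mulrCA ler_wpM2l//.
have -> : wdeg w (u |: set0) = \sum_(t | adj t u) w t; last exact: wA.
by apply: eq_bigl => t; rewrite joinedU1 /joined sub0set andbT.
Qed.

Lemma bernoulli_ineq (R : realDomainType) (x : R) m : x <= 1 ->
  1 - m%:R * x <= (1 - x) ^+ m.
Proof.
move=> x1; elim: m => [|m IH]; first by rewrite mul0r subr0.
have := ler_wpM2l (_ : 0 <= 1 - x) IH; rewrite -exprS subr_ge0 => /(_ x1).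
apply: le_trans; rewrite -natr1.
have := mulr_ge0 (ler0n R m) (sqr_ge0 x); rewrite expr2; lra.
Qed.

(** Here [m] is [r - 1]. The product regroups as [(1 - M^-2) ^+ m * ((M - 1) * M)], which Bernoulli
    bounds below by [(M - 1) ^+ 2]. *)
Lemma clique_density_constant (R : realFieldType) (m : nat) : (2 <= m)%N ->
  1 <= (1 - m%:R^-1) ^+ m.+1 * (m%:R * m%:R^-1 ^+ m.-1) * m.+1%:R ^+ m :> R.
Proof.
move=> m2; have M2 : 2%:R <= m%:R :> R by rewrite ler_nat.
set M : R := m%:R in M2 *; have M0 : M != 0 by lra.
have -> : (1 - M^-1) ^+ m.+1 * (M * M^-1 ^+ m.-1) * m.+1%:R ^+ m =
    (1 - M^-2) ^+ m * ((M - 1) * M).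
  have -> : M^-1 ^+ m.-1 = M * M^-1 ^+ m.
    by case: (m) m2 => // l _; rewrite exprS mulVKf.
  have -> : 1 - M^-2 = (1 - M^-1) * M^-1 * (M + 1) by field.
  by rewrite -natr1 -/M !exprMn exprS; field.
have M1 : 1 <= M by lra.
have x1 : M^-2 <= 1.
  by rewrite invf_le1 ?exprn_ege1 ?exprn_gt0// (lt_le_trans _ M1).
have /(ler_wpM2r (_ : 0 <= (M - 1) * M)) := bernoulli_ineq m x1.
rewrite mulr_ge0; try lra; move=> /(_ isT); apply: le_trans.
have -> : (1 - m%:R * M^-2) * ((M - 1) * M) = (M - 1) ^+ 2.
  by rewrite -/M; field.
by rewrite exprn_ege1//; lra.
Qed.

(** The last factor equals [M * c]; each earlier one is at least [M^-1] because [i.+2 <= M]. *)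
Lemma prod_ratio_ge (R : realFieldType) (c : R) (l : nat) : 0 < c ->
  l.+1%:R * c * l.+1%:R^-1 ^+ l <=
  \prod_(i < l.+1) (1 - i.+1%:R * (l.+1%:R^-1 - c)).
Proof.
move=> c0; set M : R := l.+1%:R; have M0 : 0 < M by rewrite ltr0n.
rewrite big_ord_recr /= mulrC.
have -> : 1 - l.+1%:R * (M^-1 - c) = M * c.
  by rewrite -/M mulrBr divff ?gt_eqF//; ring.
rewrite ler_wpM2r ?mulr_ge0 ?(ltW c0) ?(ltW M0)//.
rewrite -[l in M^-1 ^+ l]card_ord -prodr_const; apply: ler_prod => i _.
rewrite invr_ge0 ltW//=.
have : i.+1%:R * c >= 0 by rewrite mulr_ge0 ?ltW.
have : (i.+2%:R / M <= 1) by rewrite ler_pdivrMr// mul1r ler_nat ltnS.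
rewrite -[i.+2%:R]natr1 mulrDl mul1r; move: (i.+1%:R) (M^-1) => x y; lra.
Qed.

(** Weights are at most [(a * n)^-1], so the count is at least [(a * n) ^+ r] times the weighted
    sum; lowering [a] to [1 - M^-1] leaves the constant treated above. The bound on [c] holds
    because a weighted edge density is at most 1. *)
Lemma spectral_clique_count (R : realType) (r : nat) (c : R) (G : sgraph) :
  (3 <= r)%N -> 0 < c -> (0 < #|vertex G|)%N ->
  (1 - 1 / (r%:R - 1) + c) * #|vertex G|%:R <= largest_eigenvalue R G ->
  c <= 2^-1 /\
  c / r%:R ^+ r.-1 * #|vertex G|%:R ^+ r <= cliques (fun=> 1) r (set0 : {set vertex G}).
Proof.
case: r => // m m2 c0 n0; rewrite -natr1 addrK div1r.
have M2 : 2%:R <= m%:R :> R by rewrite ler_nat.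
set M : R := m%:R in M2 *; set a := 1 - M^-1 + c; set n := #|vertex G| in n0 * => amu.
have iM : M^-1 <= 2^-1 by rewrite lef_pV2 ?posrE; lra.
have iM0 : 0 < M^-1 by rewrite invr_gt0; lra.
have a0 : 0 < a by rewrite /a; lra.
have [w [w0 wb w1 wa]] := spectral_weight n0 a0 amu.
have a1 : a <= 1.
  apply: (le_trans wa); rewrite cliquesS -w1; apply: ler_sum => u _.
  rewrite ler_piMr//= -w1 /wdeg [X in X <= _]big_mkcond [X in _ <= X]big_mkcond.
  by apply: ler_sum => v _; rewrite /joined sub0set; case: ifP.
split; first by rewrite /a in a1; lra.
have nR : 0 < n%:R :> R by rewrite ltr0n.
have M0 : M != 0 by lra.
have oa : 1 - a = M^-1 - c by rewrite /a; ring.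
have mpos : 0 <= 1 - m%:R * (1 - a).
  rewrite oa -/M; have -> : 1 - M * (M^-1 - c) = M * c by field.
  by rewrite mulr_ge0; lra.
have := cliques_prod w0 w1 a1 wa mpos.
move=> /le_trans /(_ (cliques_scale m.+1 set0 w0 wb)); rewrite oa.
rewrite exprVn ler_pdivlMl ?exprn_gt0 ?mulr_gt0//; apply: le_trans.
have := prod_ratio_ge m.-1 c0; rewrite prednK; last by case: (m) m2.
rewrite -/M => pr.
have X0 : 0 <= (a * n%:R) ^+ m.+1 by rewrite exprn_ge0 ?mulr_ge0 ?ltW.
apply: le_trans (ler_wpM2l X0 pr).
rewrite exprMn [X in _ <= X]mulrAC ler_wpM2r ?exprn_ge0 ?(ltW nR)//=.
have K0 : 0 < (M + 1) ^+ m by rewrite exprn_gt0; lra.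
rewrite ler_pdivrMr//.
have := clique_density_constant R m2; rewrite -natr1 -/M => dc.
rewrite -[X in X <= _]mulr1; apply: le_trans (ler_wpM2l (ltW c0) dc) _.
have -> : c * ((1 - M^-1) ^+ m.+1 * (M * M^-1 ^+ m.-1) * (M + 1) ^+ m) =
    (1 - M^-1) ^+ m.+1 * (M * c * M^-1 ^+ m.-1 * (M + 1) ^+ m) by ring.
rewrite -[X in _ <= X]mulrA ler_wpM2r//.
  by rewrite !mulr_ge0 ?exprn_ge0//; lra.
by rewrite lerXn2r ?nnegrE// /a; lra.
Qed.

(** * Pigeonhole in dense bipartite graphs *)

Lemma sum_indicator (R : pzSemiRingType) (V : finType) (A : {set V}) :
  \sum_u (u \in A)%:R = #|A|%:R :> R.
Proof.
rewrite -sum1_card natr_sum [RHS]big_mkcond; apply: eq_bigr => u _.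
by case: (u \in A).
Qed.

(** Vertices [u] of degree below [q * #|I|] carry at most half of the guaranteed edges, so at least
    [q * #|V|] vertices form [U]. Their neighbourhoods take at most [2 ^ #|I|] values: [S] is a most
    frequent one and [T] its fibre. *)
Lemma dense_bipartite (R : realFieldType) (I V : finType) (E : I -> V -> bool)
    (q : R) :
  (0 < #|I|)%N -> (0 < #|V|)%N -> 0 < q ->
  (forall i, 2 * q * #|V|%:R <= #|[set u | E i u]|%:R) ->
  exists (S : {set I}) (T : {set V}),
    [/\ q * #|I|%:R <= #|S|%:R, q * #|V|%:R <= #|T|%:R * 2 ^+ #|I|
      & forall i u, i \in S -> u \in T -> E i u].
Proof.
move=> I0 V0 q0 dE.
pose nb u := [set i | E i u]; pose U := [set u | q * #|I|%:R <= #|nb u|%:R].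
have I0R : 0 < #|I|%:R :> R by rewrite ltr0n.
have V0R : 0 < #|V|%:R :> R by rewrite ltr0n.
have UV : q * #|V|%:R <= #|U|%:R.
  rewrite -(ler_pM2r I0R).
  have count : \sum_i (#|[set u | E i u]|%:R : R) = \sum_u #|nb u|%:R.
    rewrite -!natr_sum; congr _%:R.
    under eq_bigr do rewrite -sum1_card big_mkcond.
    under [RHS]eq_bigr do rewrite -sum1_card big_mkcond.
    by rewrite exchange_big; do 2!apply: eq_bigr => ? _; rewrite !inE.
  have lo : \sum_(i : I) (2 * q * #|V|%:R) <= \sum_i (#|[set u | E i u]|%:R : R).
    by apply: ler_sum => i _.
  have hi : \sum_u (#|nb u|%:R : R) <=
      \sum_u ((u \in U)%:R * #|I|%:R + q * #|I|%:R).
    apply: ler_sum => u _; rewrite inE.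
    case: (leP (q * _)) => [_|/ltW h] /=; last by rewrite mul0r add0r.
    by rewrite mul1r ler_wpDr ?mulr_ge0 ?(ltW q0) ?ler0n// ler_nat max_card.
  move: lo hi; rewrite count => /le_trans h /h.
  have -> : \sum_u ((u \in U)%:R * #|I|%:R + q * #|I|%:R) =
      #|U|%:R * #|I|%:R + q * #|I|%:R * #|V|%:R :> R.
    rewrite big_split /= -mulr_suml sumr_const sum_indicator.
    by rewrite [q * _ * _]mulr_natr.
  have -> : \sum_(i : I) (2 * q * #|V|%:R) = 2 * q * #|V|%:R * #|I|%:R.
    by rewrite sumr_const [RHS]mulr_natr.
  lra.
pose fib (S : {set I}) := [set u in U | nb u == S].
pose S := [arg max_(S > set0) #|fib S|].
have Smax S' : (#|fib S'| <= #|fib S|)%N.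
  by rewrite /S; case: arg_maxnP => // S0 _; apply.
have Ufib : #|U| = (\sum_S' #|fib S'|)%N.
  rewrite -sum1_card (partition_big nb xpredT)//=; apply: eq_bigr => S' _.
  by rewrite -sum1_card; apply: eq_bigl => u; rewrite !inE.
have US : (#|U| <= #|fib S| * 2 ^ #|I|)%N.
  rewrite Ufib -[#|I|]cardsT -card_powerset powersetT cardsT mulnC -sum_nat_const.
  exact: leq_sum.
have {}US : q * #|V|%:R <= #|fib S|%:R * 2 ^+ #|I|.
  by apply: (le_trans UV); rewrite -natrX -natrM ler_nat.
exists S, (fib S); split=> // [|i u iS]; last first.
  by rewrite inE => /andP[_ /eqP E1]; move: iS; rewrite -E1 inE.
(* Any [u] in the fibre lies in [U] and has [nb u = S], whence the lower bound on [#|S|]. *)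
have /card_gt0P[u] : (0 < #|fib S|)%N.
  rewrite lt0n; apply: contraTneq US => ->.
  by rewrite mul0r -ltNge mulr_gt0.
by rewrite !inE => /andP[h /eqP <-].
Qed.

(** * Rich cliques, and adding one part to a multipartite graph *)

Section Rich.
Variables (R : realFieldType) (G : sgraph).
Local Notation V := (vertex G).
Local Notation n := #|V|.
Implicit Types (u : V) (Q : {set V}) (v : nat -> nat -> V).

Fixpoint rich (d : R) j Q : bool :=
  if j is j'.+1 then d <= #|[set u | joined u Q & rich d j' (u |: Q)]|%:R
  else true.

Lemma cliques_le_exp j Q : cliques (fun=> 1) j Q <= n%:R ^+ j :> R.
Proof.
elim: j Q => [|j IH] Q; first exact: lexx.
apply: (@le_trans _ _ (\sum_(u : V) n%:R ^+ j)); last first.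
  by rewrite sumr_const exprS mulr_natl.
rewrite [X in X <= _]/cliques /= big_mkcond; apply: ler_sum => u _.
by case: ifP; rewrite ?exprn_ge0// mul1r => _; exact: IH.
Qed.

(** Fewer than [e * n] one-vertex extensions are rich, and these contribute at most [n ^ j] each;
    the others fall under the induction hypothesis. Each level thus adds one to the factor [j]. *)
Lemma cliques_lt_not_rich (e : R) j Q : (0 < n)%N -> 0 <= e ->
  ~~ rich (e * n%:R) j Q ->
  cliques (fun=> 1) j Q < j%:R * e * n%:R ^+ j.
Proof.
move=> n0 e0; elim: j Q => // j IH Q; rewrite [rich _ _ _]/= -ltNge.
have nR : 0 < n%:R :> R by rewrite ltr0n.
set A := [set u | _] => hA.
have nj : 0 < n%:R ^+ j :> R by rewrite exprn_gt0.
apply: (@le_lt_trans _ _ (\sum_(u : V) ((u \in A)%:R * n%:R ^+ j +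
    j%:R * e * n%:R ^+ j))).
  rewrite /cliques /= big_mkcond; apply: ler_sum => u _; rewrite mul1r inE.
  have b0 : 0 <= j%:R * e * n%:R ^+ j by rewrite !mulr_ge0// ltW.
  case: ifP => [uQ|_] /=; last by rewrite mul0r add0r.
  have [_|] := boolP (rich _ _ _).
    by rewrite mul1r ler_wpDr// cliques_le_exp.
  by rewrite mul0r add0r => /IH/ltW.
rewrite big_split /= -mulr_suml sumr_const sum_indicator.
rewrite -[(_ * _) *+ _]mulr_natl -natr1 exprS; move: hA; rewrite -(ltr_pM2r nj); nra.
Qed.

(** Total functions [v] make reindexing free of dependent types. Vertices of different parts are
    distinct because they are adjacent and [adj] is irreflexive. *)
Definition multipart (sz : nat -> nat) k v : Prop :=
  (forall a i j, (a < k)%N -> (i < sz a)%N -> (j < sz a)%N ->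
     v a i = v a j -> i = j) /\
  (forall a b i j, (a < k)%N -> (b < k)%N -> a != b ->
     (i < sz a)%N -> (j < sz b)%N -> adj (v a i) (v b j)).

(** The transversal with index [i] in every part: one of the disjoint cliques to be extended. *)
Definition slice v k i : {set V} := [set v a i | a : 'I_k].

Lemma multipart_contains (p : seq nat) v :
  multipart (nth 0%N p) (size p) v ->
  contains_subgraph G (complete_multipartite p).
Proof.
move=> [vinj vadj].
exists (fun x : vertex (complete_multipartite p) => v (tag x) (tagged x)).
split=> [[a i] [b j] /= | [a i] [b j] /= ab]; last exact: vadj.
case: (eqVneq a b) j => [<- j /vinj ij | ab j E].
  by congr existT; apply/val_inj/ij.
by have := vadj a b i j (ltn_ord a) (ltn_ord b) ab (ltn_ord i) (ltn_ord j);
  rewrite E adj_irr.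
Qed.

(** The old parts are reindexed by [S], and [T] supplies the new part. Since all of [T] is joined to
    every slice from [S], the two enumerations can be paired index by index. *)
Lemma multipart_extend m k v (S : {set 'I_m}) (T : {set V}) m' t :
  (0 < n)%N -> multipart (fun=> m) k v ->
  (forall i u, i \in S -> u \in T -> joined u (slice v k i)) ->
  (m' <= #|S|)%N -> (t <= #|T|)%N ->
  exists2 v', multipart (fun a => if (a < k)%N then m' else t) k.+1 v' &
    forall i, (i < m')%N -> (i < t)%N -> exists i0 u,
      [/\ i0 \in S, u \in T & slice v' k.+1 i = u |: slice v k i0].
Proof.
move=> /card_gt0P[x0 _] [vinj vadj] ST mS tT.
pose sg i := nth 0%N (map val (enum S)) i; pose tu i := nth x0 (enum T) i.
have sgP i : (i < m')%N -> exists2 i0, i0 \in S & sg i = val i0.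
  move=> im; have : sg i \in map val (enum S).
    by rewrite mem_nth// size_map -cardE (leq_trans im).
  by move=> /mapP[i0]; rewrite mem_enum; exists i0.
have sg_inj i j : (i < m')%N -> (j < m')%N -> sg i = sg j -> i = j.
  move=> im jm /eqP; rewrite nth_uniq ?size_map -?cardE ?(leq_trans im)//.
  - by move/eqP.
  - by rewrite (leq_trans jm).
  - by rewrite map_inj_uniq ?enum_uniq//; exact: val_inj.
have tuP i : (i < t)%N -> tu i \in T.
  by move=> it; rewrite -mem_enum mem_nth// -cardE (leq_trans it).
have tu_inj i j : (i < t)%N -> (j < t)%N -> tu i = tu j -> i = j.
  move=> it jt /eqP; rewrite nth_uniq -?cardE ?(leq_trans it) ?(leq_trans jt)//.
  - by move/eqP.
  - exact: enum_uniq.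
have cross a i j : (a < k)%N -> (i < m')%N -> (j < t)%N ->
    adj (tu j) (v a (sg i)).
  move=> ak /sgP[i0 i0S ->] /tuP jT; have /subsetP := ST _ _ i0S jT.
  by move=> /(_ (v a i0)); rewrite inE; apply; apply/imsetP; exists (Ordinal ak).
exists (fun a i => if (a < k)%N then v a (sg i) else tu i).
  split=> [a i j | a b i j].
    rewrite ltnS => _; case: ifP => [ak im jm|_]; last exact: tu_inj.
    have [[i0 _ E1] [j0 _ E2]] := (sgP i im, sgP j jm).
    by move=> E; apply: sg_inj => //; apply: vinj ak _ _ E; rewrite ?E1 ?E2 ltn_ord.
  rewrite !ltnS => ak bk ab; case: ifP => [ak1|ak1]; case: ifP => [bk1|bk1].
  - move=> /sgP[i0 _ ->] /sgP[j0 _ ->]; apply: vadj => //; exact: ltn_ord.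
  - by move=> im jt; rewrite adj_sym cross.
  - by move=> it jm; rewrite cross.
  - move: ab; suff -> : a = b by rewrite eqxx.
    by apply/eqP; rewrite eqn_leq (leq_trans ak) ?(leq_trans bk)// leqNgt ?ak1 ?bk1.
move=> i im it; have [i0 i0S E] := sgP i im.
exists i0, (tu i); split; [by []|exact: tuP|].
apply/setP => x; rewrite in_setU1; apply/imsetP/orP.
  move=> [[a /= ak] _ ->]; case: ifP => ak1; last by left.
  by right; apply/imsetP; exists (Ordinal ak1); rewrite // E.
move=> [/eqP -> | /imsetP[a _ ->]].
  by exists ord_max; rewrite //= ltnn.
by exists (widen_ord (leqnSn k) a); rewrite //= ltn_ord E.
Qed.

Lemma rich_extend (q : R) m k v j m' t :
  (0 < n)%N -> 0 < q -> (0 < m)%N -> multipart (fun=> m) k v ->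
  (forall i, (i < m)%N -> rich (2 * q * n%:R) j.+1 (slice v k i)) ->
  m'%:R < q * m%:R + 1 -> t%:R < q * n%:R / 2 ^+ m + 1 ->
  exists2 v', multipart (fun a => if (a < k)%N then m' else t) k.+1 v' &
    forall i, (i < m')%N -> (i < t)%N -> rich (2 * q * n%:R) j (slice v' k.+1 i).
Proof.
move=> n0 q0 m0 mv vr hm' ht.
pose E (i : 'I_m) u := joined u (slice v k i) &&
  rich (2 * q * n%:R) j (u |: slice v k i).
have [|i|S [T [hS hT ST]]] := dense_bipartite (E := E) _ n0 q0.
- by rewrite card_ord.
- exact/vr/ltn_ord.
rewrite card_ord in hS hT.
(* The slack [+ 1] lets [m'] be the ceiling of the real bound, which the integer [#|S|] still
   reaches. *)
have m'S : (m' <= #|S|)%N.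
  by rewrite -ltnS -(ltr_nat R) (lt_le_trans hm')// -(natr1 #|S|) lerD2r.
have tT : (t <= #|T|)%N.
  rewrite -ltnS -(ltr_nat R) (lt_le_trans ht)// -(natr1 #|T|) lerD2r.
  by rewrite ler_pdivrMr// exprn_gt0.
have [|v' mv' sv'] := multipart_extend n0 mv _ m'S tT.
  by move=> i u iS uT; have /andP[] := ST i u iS uT.
exists v' => // i im it; have [i0 [u [iS uT ->]]] := sv' i im it.
by have /andP[] := ST _ _ iS uT.
Qed.

End Rich.

(** * Building the parts one at a time *)

Lemma eq_multipart (G : sgraph) (sz sz' : nat -> nat) k (v : nat -> nat -> vertex G) :
  (forall a, (a < k)%N -> sz a = sz' a) -> multipart sz k v -> multipart sz' k v.
Proof.
move=> E [vinj vadj]; split=> [a i j ak | a b i j ak bk].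
  by rewrite -E//; exact: vinj.
by rewrite -!E//; exact: vadj.
Qed.

(* The number of indices needed at the stage where [j] parts are missing: each
   further part keeps a proportion [q] of them, and [s] must remain. *)
Definition stage_size (R : realType) (q : R) (s j : nat) : nat :=
  (Num.trunc (s%:R / q ^+ j)).+1.

Lemma stage_size_gt (R : realType) (q : R) s j : 0 < q ->
  s%:R / q ^+ j < (stage_size q s j)%:R.
Proof. by move=> q0; rewrite -truncn_le_nat. Qed.

Lemma stage_size_le (R : realType) (q : R) s j : 0 < q ->
  (stage_size q s j)%:R <= s%:R / q ^+ j + 1.
Proof.
by move=> q0; rewrite -natr1 lerD2r truncn_le divr_ge0// exprn_ge0// ltW.
Qed.

Lemma leq_stage_size (R : realType) (q : R) s i j : 0 < q -> q <= 1 ->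
  (i <= j)%N -> (stage_size q s i <= stage_size q s j)%N.
Proof.
move=> q0 q1 ij; rewrite ltnS le_truncn// ler_wpM2l//.
by rewrite lef_pV2 ?posrE ?exprn_gt0// ler_wiXn2l// ltW.
Qed.

(** After [k.+1] parts, [m (r.+1 - k)] slices are rich at level [r.+1 - k]. The largest stage only
    has to leave room for the next few slices; [t] is limited by [stage_size q s 1], the number of
    slices at the last extension. *)
Lemma rich_multipart (R : realType) (G : sgraph) (q : R) (r s t : nat) :
  (0 < #|vertex G|)%N -> 0 < q -> q <= 1 ->
  rich (2 * q * #|vertex G|%:R) r.+2 (set0 : {set vertex G}) ->
  (stage_size q s r.+1)%:R * 2 ^+ (stage_size q s r.+1) <= q * #|vertex G|%:R ->
  t%:R < q * #|vertex G|%:R / 2 ^+ (stage_size q s 1) + 1 ->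
  exists v : nat -> nat -> vertex G,
    multipart (fun a => if (a < r.+1)%N then s else t) r.+2 v.
Proof.
move=> n0 q0 q1 rich0 big ht; pose m := stage_size q s.
set n := #|vertex G| in n0 rich0 big ht; pose d := 2 * q * n%:R.
have nR : 0 < n%:R :> R by rewrite ltr0n.
have mbig i j : (i <= r.+1)%N -> (j <= r.+1)%N ->
    (m i)%:R <= q * n%:R / 2 ^+ m j.
  move=> ir jr; rewrite ler_pdivlMr ?exprn_gt0//; apply: le_trans big.
  rewrite ler_pM ?exprn_ge0// ?ler_nat ?leq_stage_size//.
  by rewrite ler_eXn2l ?ltr1n// leq_stage_size.
have mstep j : (m j)%:R < q * (m j.+1)%:R + 1.
  apply: (le_lt_trans (stage_size_le s j q0)); rewrite ltrD2r.
  have := stage_size_gt s j.+1 q0; rewrite -(ltr_pM2l q0); apply: le_lt_trans.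
  by rewrite exprS invfM mulrCA mulVKf// gt_eqF.
suff stage k : (k <= r)%N -> exists2 v : nat -> nat -> vertex G,
    multipart (fun=> m (r.+1 - k)%N) k.+1 v &
    forall i, (i < m (r.+1 - k)%N)%N -> rich d (r.+1 - k)%N (slice v k.+1 i).
  have [v mv rv] := stage r (leqnn r); rewrite subSnn in mv rv.
  have hs : s%:R < q * (m 1%N)%:R + 1.
    have := stage_size_gt s 1 q0; rewrite -(ltr_pM2l q0) expr1.
    rewrite mulrC mulfVK ?gt_eqF// => /lt_le_trans; apply.
    by rewrite lerDl.
  have [v' mv' _] := rich_extend n0 q0 (ltn0Sn _) mv rv hs ht.
  by exists v'.
elim: k => [|k IH] kr.
  rewrite subn0; have /card_gt0P[x0 _] := n0.
  pose T := [set u | joined u set0 & rich d r.+1 (u |: (set0 : {set vertex G}))].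
  have m1T : (m r.+1 <= #|T|)%N.
    rewrite -(ler_nat R); apply: le_trans (_ : d <= _); last exact: rich0.
    apply: (le_trans (mbig _ _ (leqnn _) (leqnn _))); rewrite /d ler_pdivrMr ?exprn_gt0//.
    have p1 : 1 <= 2 ^+ m r.+1 :> R by rewrite exprn_ege1// ler1n.
    by have := mulr_gt0 q0 nR; nra.
  (* The first part is an extension of zero parts: all slices are empty and [x0] is a dummy
     value. *)
  have m0 : multipart (fun=> m r.+1) 0 (fun _ _ => x0) by [].
  have mI : (m r.+1 <= #|[set: 'I_(m r.+1)]|)%N by rewrite cardsT card_ord.
  have s0 i : slice (fun _ _ => x0) 0 i = set0.
    by apply/setP => x; rewrite inE; apply/negP => /imsetP[[]].
  have [|v mv sv] := multipart_extend n0 m0 _ mI m1T.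
    by move=> i u _ _; rewrite s0 /joined sub0set.
  exists v => [|i im].
    by apply: eq_multipart mv => a; rewrite ltnS leqn0 => /eqP ->.
  have [i0 [u [_ + ->]]] := sv i im im.
  by rewrite s0 inE => /andP[].
have [v mv rv] := IH (ltnW kr).
have E : (r.+1 - k = (r.+1 - k.+1).+1)%N by rewrite subSS subSn// ltnW.
rewrite E in mv rv; have jr : (r.+1 - k.+1 < r.+1)%N by rewrite subSS ltnS leq_subr.
move: (r.+1 - k.+1)%N jr mv rv {E} => j jr mv rv.
have hm : (m j)%:R < q * n%:R / 2 ^+ m j.+1 + 1.
  by rewrite (le_lt_trans (mbig j j.+1 _ _)) ?ltrDl// ltnW.
have [v' mv' rv'] := rich_extend n0 q0 (ltn0Sn _) mv rv (mstep j) hm.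
exists v' => [|i im]; last exact: rv'.
by apply: eq_multipart mv' => a _; case: ifP.
Qed.

(** * Exponential estimates for the two size conditions *)

Lemma exp2_le_expR (R : realType) m : 2 ^+ m <= expR m%:R :> R.
Proof.
have -> : m%:R = 1 * m%:R :> R by rewrite mul1r.
rewrite expRM_natr lerXn2r ?nnegrE ?expR_ge0//.
by apply: le_trans (expR_ge1Dx 1).
Qed.

Lemma inv_le_expR (R : realType) (q : R) : q^-1 < expR q^-1.
Proof. by apply: lt_le_trans (expR_ge1Dx _); rewrite ltrDr. Qed.

(** Both [m] and [2 ^ m] are at most [expR m], and bounding [q^-1] by its exponential costs only an
    additive [q^-1] in the exponent. *)
Lemma exp2_bound (R : realType) (q : R) (N : nat) m : (0 < N)%N -> 0 < q ->
  2 * m%:R + q^-1 <= ln N%:R -> m%:R * 2 ^+ m <= q * N%:R.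
Proof.
move=> N0 q0 h; rewrite -ler_pdivrMl// -[N%:R]lnK ?posrE ?ltr0n//.
apply: le_trans (_ : expR (2 * m%:R + q^-1) <= _); last by rewrite ler_expR.
rewrite expRD mulrC ler_pM ?invr_ge0 ?mulr_ge0 ?exprn_ge0 ?(ltW q0)//; last first.
  exact/ltW/inv_le_expR.
rewrite expRM_natl expr2 ler_pM ?exprn_ge0 ?exp2_le_expR//.
by apply: le_trans (expR_ge1Dx _); rewrite lerDr.
Qed.

(** Used with [g = c ^+ r.-1] and [m] the number of slices at the last extension, to make the last
    part large. *)
Lemma powR_bound (R : realType) (q g : R) (N : nat) m : (0 < N)%N -> 0 < q ->
  m%:R + q^-1 <= g * ln N%:R -> powR N%:R (1 - g) < q * N%:R / 2 ^+ m.
Proof.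
move=> N0 q0 h; have NR : 0 < N%:R :> R by rewrite ltr0n.
rewrite ltr_pdivlMr ?exprn_gt0// -ltr_pdivrMl//.
rewrite /powR gt_eqF// -[X in _ < X]lnK ?posrE//.
apply: lt_le_trans (_ : expR (q^-1 + ((1 - g) * ln N%:R + m%:R)) <= _); last first.
  by rewrite ler_expR; lra.
rewrite !expRD; apply: (@lt_le_trans _ _
  (expR q^-1 * (expR ((1 - g) * ln N%:R) * 2 ^+ m))).
  by rewrite ltr_pM2r ?inv_le_expR// mulr_gt0 ?expR_gt0 ?exprn_gt0.
by rewrite !ler_wpM2l ?expR_ge0 ?exp2_le_expR.
Qed.

(** * Numerical verification of the exponents *)

Section Constants.
Variables (R : realType) (r : nat) (c L : R).
Hypotheses (hr : (3 <= r)%N) (c0 : 0 < c) (c2 : c <= 2^-1).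
Let p := c / r%:R ^+ r.
Hypothesis hL : 1 <= p ^+ r * L.
Variable s : nat.
Hypothesis hs : s%:R <= p ^+ r * L.

Let r3 : 3 <= r%:R :> R. Proof. by rewrite ler_nat. Qed.

Let rr : 27 <= r%:R ^+ r :> R.
Proof.
have -> : 27 = 3 ^+ 3 :> R by rewrite !exprS expr0; lra.
apply: (@le_trans _ _ (r%:R ^+ 3)); first by rewrite lerXn2r ?nnegrE.
by rewrite ler_weXn2l// (le_trans _ r3)// ler1n.
Qed.

Let p0 : 0 < p. Proof. by rewrite divr_gt0// (lt_le_trans _ rr). Qed.

Let p54 : p <= 54^-1.
Proof.
rewrite ler_pdivrMr ?(lt_le_trans _ rr)//.
by move: (r%:R ^+ r) rr c2 => B; lra.
Qed.

Let L0 : 0 < L.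
Proof.
by rewrite -(pmulr_rgt0 _ (exprn_gt0 r p0)) (lt_le_trans ltr01 hL).
Qed.

(** A scale for the error terms: [p * y = p ^+ r * L] is at least 1 by [hL], so multiples of [y]
    absorb the reciprocals [p^-1]. *)
Let y := p ^+ r.-1 * L.

Let yp : p^-1 <= y.
Proof.
rewrite -div1r ler_pdivrMr// mulrC mulrA -exprS prednK//.
by case: (r) hr.
Qed.

Let ip54 : 54 <= p^-1.
Proof. by rewrite -[54]invrK lef_pV2 ?posrE ?invr_gt0. Qed.

Let yL : y <= 54^-1 ^+ 2 * L.
Proof.
rewrite ler_wpM2r ?(ltW L0)//; apply: (@le_trans _ _ (p ^+ 2)).
  rewrite ler_wiXn2l ?(ltW p0)//; first by apply: (le_trans p54); lra.
  by case: (r) hr => [|[|[|]]].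
by rewrite lerXn2r ?nnegrE// ?(ltW p0)//; lra.
Qed.

(** The left side is at most [4 * y + 1]; the right side is at least [27 * y], since
    [c = p * r ^+ r] and [r ^+ r >= 27]. *)
Lemma first_stage_exponent :
  (stage_size (p / 2) s 1)%:R + (p / 2)^-1 <= c ^+ r.-1 * L.
Proof.
have q0 : 0 < p / 2 by rewrite divr_gt0.
have m1 : (stage_size (p / 2) s 1)%:R <= 2 * y + 1.
  apply: (le_trans (stage_size_le s 1 q0)); rewrite lerD2r expr1.
  rewrite ler_pdivrMr//; apply: (le_trans hs).
  have -> : p ^+ r = p * p ^+ r.-1 by rewrite -exprS prednK//; case: (r) hr.
  by rewrite /y; lra.
have cy : 27 * y <= c ^+ r.-1 * L.
  rewrite /y mulrA ler_wpM2r ?(ltW L0)//.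
  have -> : c ^+ r.-1 = (r%:R ^+ r) ^+ r.-1 * p ^+ r.-1.
    by rewrite -exprMn /p mulrC divfK// gt_eqF// (lt_le_trans _ rr).
  rewrite ler_wpM2r ?exprn_ge0 ?(ltW p0)//; apply: (le_trans rr).
  rewrite -[X in X <= _]expr1 ler_weXn2l//; first by have := rr; lra.
  by case: (r) hr => [|[|]].
have -> : (p / 2)^-1 = 2 * p^-1 by rewrite invfM invrK mulrC.
by have := yp; have := ip54; lra.
Qed.

(** Dividing [s <= p ^+ r * L] by [(p / 2) ^+ r.-1] leaves [2 ^+ r.-1 * p * L], where
    [2 ^+ r.-1 * p = (2 / r) ^+ r * (c / 2)] is at most [2 / 27]. *)
Lemma last_stage_exponent :
  2 * (stage_size (p / 2) s r.-1)%:R + (p / 2)^-1 <= L.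
Proof.
have q0 : 0 < p / 2 by rewrite divr_gt0.
have m1 : (stage_size (p / 2) s r.-1)%:R <= 2 ^+ r.-1 * p * L + 1.
  apply: (le_trans (stage_size_le s _ q0)); rewrite lerD2r.
  rewrite ler_pdivrMr ?exprn_gt0//; apply: (le_trans hs).
  have -> : p ^+ r = p * p ^+ r.-1 by rewrite -exprS prednK//; case: (r) hr.
  have u0 : 2 ^+ r.-1 != 0 :> R by rewrite lt0r_neq0 ?exprn_gt0.
  have -> : (p / 2) ^+ r.-1 = p ^+ r.-1 / 2 ^+ r.-1.
    by rewrite [LHS]exprMn exprVn.
  move: (2 ^+ r.-1) (p ^+ r.-1) u0 => u x u0.
  by rewrite [X in _ <= X](_ : _ = p * x * L)//; field.
have p2 : 2 ^+ r.-1 * p <= 2 / 27.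
  have h : (2 / r%:R) ^+ r <= 8 / 27 :> R.
    apply: (@le_trans _ _ ((2 / 3) ^+ r)).
      rewrite lerXn2r ?nnegrE ?divr_ge0//.
      by rewrite ler_pM2l// lef_pV2 ?posrE// (lt_le_trans _ r3).
    apply: (@le_trans _ _ ((2 / 3) ^+ 3)); last by rewrite !exprS expr0; lra.
    by rewrite ler_wiXn2l//; lra.
  have -> : 2 ^+ r.-1 * p = (2 / r%:R) ^+ r * (c / 2).
    have -> : (2 / r%:R) ^+ r = 2 * 2 ^+ r.-1 / r%:R ^+ r :> R.
      by rewrite exprMn exprVn -exprS prednK//; case: (r) hr.
    by rewrite /p; field; rewrite gt_eqF// (lt_le_trans _ rr).
  apply: (@le_trans _ _ (8 / 27 * (c / 2))); last by move: (c) c2 => x; lra.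
  by rewrite ler_wpM2r ?divr_ge0 ?(ltW c0).
have p2L : 2 ^+ r.-1 * p * L <= 2 / 27 * L by rewrite ler_wpM2r// ltW.
have -> : (p / 2)^-1 = 2 * p^-1 by rewrite invfM invrK mulrC.
move: yp ip54 yL m1 p2L L0; rewrite expr2.
move: L (p^-1) y (2 ^+ r.-1 * p * L) (stage_size _ _ _)%:R => l ip y' z m; lra.
Qed.

End Constants.

(** * Choice of [q], [s] and [t] *)

Theorem theorem1 (R : realType) (r : nat) (c : R) (n : nat) (G : sgraph)
    (hr : (3 <= r)%N) (hc : 0 < c) (hn : (0 < n)%N)
    (hln : 1 <= (c / r%:R ^+ r) ^+ r * ln (n%:R : R))
    (hG : #|vertex G| = n)
    (hmu : (1 - 1 / (r%:R - 1) + c) * n%:R <= largest_eigenvalue R G) :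
  exists s t : nat,
    [/\ Num.floor ((c / r%:R ^+ r) ^+ r * ln (n%:R : R)) <= s%:Z,
        powR (n%:R : R) (1 - c ^+ (r - 1)) < t%:R
      & contains_subgraph G (complete_multipartite (rcons (nseq (r - 1) s) t))].
Proof.
have n0 : (0 < #|vertex G|)%N by rewrite hG.
have := spectral_clique_count hr hc n0; rewrite hG => /(_ hmu)[c2 cl].
case: r hr hln hmu cl => [|[|r']] // hr hln hmu cl.
set r := r'.+2 in hr hln hmu cl *.
set p := c / _ in hln *; set L := ln _ in hln *.
have rr0 : 0 < r%:R ^+ r :> R by rewrite exprn_gt0// ltr0n.
have p0 : 0 < p by rewrite divr_gt0.
(* Then [r * (2 * q)] is exactly the clique density [c / r ^+ r.-1], so the empty clique must be
   rich. *)
pose q := p / 2; have q0 : 0 < q by rewrite divr_gt0.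
have rich0 : rich (2 * q * n%:R) r (set0 : {set vertex G}).
  apply/negPn/negP => nr; rewrite -hG in nr.
  have := cliques_lt_not_rich n0 (mulr_ge0 (ler0n R 2) (ltW q0)) nr.
  have -> : r%:R * (2 * q) = c / r%:R ^+ r.-1.
    rewrite /q /p [r%:R ^+ r]exprS /=; field.
    by rewrite expf_neq0 pnatr_eq0.
  by rewrite ltNge hG cl.
pose s := `|Num.floor (p ^+ r * L)|%N.
have sE : s%:Z = Num.floor (p ^+ r * L).
  by rewrite gez0_abs// floor_ge0 (le_trans ler01).
have sle : s%:R <= p ^+ r * L.
  by have := floor_le (p ^+ r * L); rewrite -sE.
(* Exceeds the power by at most 1, which is the slack that [rich_multipart] allows for [t]. *)
pose t := (Num.trunc (powR (n%:R : R) (1 - c ^+ r.-1))).+1.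
have tgt : powR (n%:R : R) (1 - c ^+ r.-1) < t%:R by exact: truncnS_gt.
have q1 : q <= 1.
  have r1 : 1 <= r%:R ^+ r :> R by rewrite exprn_ege1// ler1n.
  have : p <= 1 by rewrite /p ler_pdivrMr// mul1r; lra.
  by rewrite /q; lra.
have big := exp2_bound hn q0 (last_stage_exponent hr hc c2 hln sle).
have small := powR_bound hn q0 (first_stage_exponent hr hc c2 hln sle).
rewrite -hG in rich0 big small.
have [|v mv] := rich_multipart n0 q0 q1 rich0 big (t := t) _.
  apply: le_lt_trans (_ : _ <= powR n%:R (1 - c ^+ r.-1) + 1) _.
    by rewrite -natr1 lerD2r truncn_le powR_ge0.
  by rewrite ltrD2r -hG.
exists s, t; split; [by rewrite sE | by rewrite subn1 |].
apply: (@multipart_contains _ _ v); rewrite size_rcons size_nseq subn1.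
apply: eq_multipart mv => a; rewrite nth_rcons size_nseq nth_nseq ltnS => ar.
by case: ltngtP ar.
Qed.
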